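(* Let $s,t$ be real numbers and let $(G_n)_{n\ge0}$ be defined by $G_0=t-s$, $G_1=s$, $G_{n+1}=G_n+G_{n-1}$ (so $G_2=t$). Let $n\ge 0$ and $k\ge1$ be integers, and let $T$ be the triangle with vertices $(G_n,G_{n+k})$, $(G_{n+2k},G_{n+3k})$, $(G_{n+4k},G_{n+5k})$. Then the area of $T$ equals $\dfrac{5\,|s^2+st-t^2|}{2}F_k^4L_k$ if $k$ is even, and $\dfrac{|s^2+st-t^2|}{2}F_k^2L_k^3$ if $k$ is odd.
   Context: $F_n$ denotes the Fibonacci numbers ($F_0=0$, $F_1=1$, $F_{n+1}=F_n+F_{n-1}$) and $L_n$ the Lucas numbers ($L_0=2$, $L_1=1$, $L_{n+1}=L_n+L_{n-1}$). The area of the triangle with vertices $(x_1,y_1),(x_2,y_2),(x_3,y_3)$ is $\frac12\left|(x_2-x_1)(y_3-y_1)-(x_3-x_1)(y_2-y_1)\right|$. *)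

(* Defs.v *)
From mathcomp Require Import all_boot all_order all_algebra.
From mathcomp Require Import reals.

Set Implicit Arguments.
Unset Strict Implicit.
Unset Printing Implicit Defensive.

Import Order.TTheory GRing.Theory Num.Theory.
Local Open Scope ring_scope.

Fixpoint fib (n : nat) : nat :=
  match n with
  | 0 => 0
  | n1.+1 => match n1 with 0 => 1 | n2.+1 => fib n1 + fib n2 end
  end%N.

Fixpoint lucas (n : nat) : nat :=
  match n with
  | 0 => 2
  | n1.+1 => match n1 with 0 => 1 | n2.+1 => lucas n1 + lucas n2 end
  end%N.

Fixpoint gib (R : realType) (s t : R) (n : nat) : R :=
  match n with
  | 0%N => t - s
  | n1.+1 =>
    match n1 with 0%N => s | n2.+1 => gib s t n1 + gib s t n2 end
  end.

Definition triangle_area (R : realType) (P1 P2 P3 : R * R) : R :=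
  2^-1 * `|(P2.1 - P1.1) * (P3.2 - P1.2) - (P3.1 - P1.1) * (P2.2 - P1.2)|.

(* Main.v *)
Require Import Defs.
From mathcomp Require Import all_boot all_order all_algebra.
From mathcomp Require Import reals.
From mathcomp Require Import ring zify.

Import Order.TTheory GRing.Theory Num.Theory.
Local Open Scope ring_scope.

(** With [u j = G (n + j k)] and [e = (-1)^k], the sequence [u] satisfies
    [u (j+2) = L_k u (j+1) - e u j], so the doubled signed area is a quadratic
    form in [u 0], [u 1], equal to [u1^2 - L_k u0 u1 + e u0^2] times a
    polynomial in [L_k] and [e].  That quadratic form is [F_k^2] times the
    Cassini invariant [G (n+1)^2 - G (n+1) G n - G n^2 = ±(s^2 + st - t^2)],
    and [L_k^2 = 5 F_k^2 + 4 e] simplifies the polynomial factor. *)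

Section Gibonacci.
Variable R : realType.
Implicit Types s t : R.

Lemma gibSS s t n : gib s t n.+2 = gib s t n.+1 + gib s t n.
Proof. by []. Qed.

Lemma fib_gib n : (fib n)%:R = gib 1 1 n :> R.
Proof.
have [] : (fib n)%:R = gib 1 1 n :> R /\ (fib n.+1)%:R = gib 1 1 n.+1 :> R.
  elim: n => [|n [IH1 IH2]]; first by rewrite /= subrr.
  by split=> //; rewrite gibSS -IH1 -IH2 -natrD.
by [].
Qed.

(** Lets [ring] treat Lucas numbers as combinations of two consecutive Fibonacci numbers; the shift
    by one avoids a predecessor. *)
Lemma lucasS_fib k : lucas k.+1 = (fib k.+1 + 2 * fib k)%N.
Proof.
have [] : lucas k.+1 = (fib k.+1 + 2 * fib k)%N /\
          lucas k.+2 = (fib k.+2 + 2 * fib k.+1)%N.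
  elim: k => [|k [IH1 IH2]] //; split=> //.
  have -> : lucas k.+3 = (lucas k.+2 + lucas k.+1)%N by [].
  have -> : fib k.+3 = (fib k.+2 + fib k.+1)%N by [].
  rewrite IH1 IH2.
  have -> : fib k.+2 = (fib k.+1 + fib k)%N by [].
  lia.
by [].
Qed.

Lemma gib_addS s t m k :
  gib s t (m + k.+1) = (fib k.+1)%:R * gib s t m.+1 + (fib k)%:R * gib s t m.
Proof.
elim: k m => [|k IH] m; first by rewrite addn1 /= mul1r mul0r addr0.
rewrite -addSnnS IH gibSS.
have -> : fib k.+2 = (fib k.+1 + fib k)%N by [].
by rewrite natrD; ring.
Qed.

(** Passing from (a, b) to (a + b, a) negates the form a^2 - a b - b^2. *)
Lemma gib_cassini s t n :
  gib s t n.+1 ^+ 2 - gib s t n.+1 * gib s t n - gib s t n ^+ 2 =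
  (-1) ^+ n * (s ^+ 2 + s * t - t ^+ 2).
Proof.
elim: n => [|n IH]; first by rewrite /=; ring.
by rewrite (exprS (-1)) -mulrA -IH gibSS; ring.
Qed.

Lemma fib_cassini k :
  (fib k.+1)%:R ^+ 2 - (fib k.+1)%:R * (fib k)%:R - (fib k)%:R ^+ 2 =
  (-1) ^+ k :> R.
Proof. by rewrite !fib_gib gib_cassini; ring. Qed.

(** With a = F_k and b = F_(k-1), (a + 2b)^2 = 5a^2 - 4(a^2 - ab - b^2), and Cassini evaluates the
    last bracket. *)
Lemma lucas_sqr k : (0 < k)%N ->
  (lucas k)%:R ^+ 2 = 5 * (fib k)%:R ^+ 2 + 4 * (-1) ^+ k :> R.
Proof.
by case: k => // k _; rewrite lucasS_fib natrD natrM (exprS (-1)) -fib_cassini; ring.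
Qed.

(** Once expanded in G_m and G_(m+1), the two sides agree by Cassini for Fibonacci numbers, the
    source of the sign. *)
Lemma gib_step s t m k : (0 < k)%N ->
  gib s t (m + k + k) =
  (lucas k)%:R * gib s t (m + k) - (-1) ^+ k * gib s t m.
Proof.
case: k => // k _.
rewrite gib_addS -addSn !gib_addS gibSS lucasS_fib natrD natrM.
by rewrite (exprS (-1)) -fib_cassini; ring.
Qed.

Lemma gib_step_form s t m k : (0 < k)%N ->
  gib s t (m + k) ^+ 2 - (lucas k)%:R * gib s t m * gib s t (m + k)
    + (-1) ^+ k * gib s t m ^+ 2 =
  (fib k)%:R ^+ 2 * ((-1) ^+ m * (s ^+ 2 + s * t - t ^+ 2)).
Proof.
case: k => // k _; rewrite -gib_cassini gib_addS lucasS_fib natrD natrM.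
by rewrite (exprS (-1)) -fib_cassini; ring.
Qed.

End Gibonacci.

Theorem theorem2p4 (R : realType) (s t : R) (n k : nat) (hk : (1 <= k)%N) :
  let G := gib s t in
  let area := triangle_area (G n, G (n + k)%N)
                            (G (n + 2 * k)%N, G (n + 3 * k)%N)
                            (G (n + 4 * k)%N, G (n + 5 * k)%N) in
  (~~ odd k ->
     area = 5 * `|s ^+ 2 + s * t - t ^+ 2| / 2
            * (fib k)%:R ^+ 4 * (lucas k)%:R) /\
  (odd k ->
     area = `|s ^+ 2 + s * t - t ^+ 2| / 2
            * (fib k)%:R ^+ 2 * (lucas k)%:R ^+ 3).
Proof.
move=> G area; rewrite {}/area /triangle_area /=.
have step j : G (n + j.+2 * k)%N =
    (lucas k)%:R * G (n + j.+1 * k)%N - (-1) ^+ k * G (n + j * k)%N.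
  have -> : (n + j.+2 * k = n + j * k + k + k)%N by lia.
  have -> : (n + j.+1 * k = n + j * k + k)%N by lia.
  exact: gib_step.
have := gib_step_form R s t n k hk; rewrite -/G.
have := lucas_sqr R k hk.
(* All coordinates reduce to [u] and [v] below; with exponent [odd k], the sign is evaluated by the
   parity hypothesis. *)
rewrite !step mul1n mul0n addn0 -[(-1) ^+ k]signr_odd.
set u := G n; set v := G (n + k)%N.
set L := (lucas k)%:R; set F := (fib k)%:R; set Q := s ^+ 2 + s * t - t ^+ 2.
have normQ c : 0 <= c -> `|c * ((-1) ^+ n * Q)| = c * `|Q|.
  by move=> c0; rewrite !normrM normrX normrN1 expr1n mul1r (ger0_norm c0).
have [L0 F0] : 0 <= L /\ 0 <= F by rewrite !ler0n.
move=> lucasE formE; split=> par.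
(* The determinant is L (L^2 - 2 - 2e) times the left side of [formE]; here e = 1, which gives L
   (L^2 - 4). *)
- move: lucasE formE; rewrite (negbTE par) expr0 => lucasE formE.
  have L2 : L ^+ 2 - 4 = 5 * F ^+ 2 by rewrite lucasE; ring.
  transitivity (2^-1 * `|(5 * F ^+ 4 * L) * ((-1) ^+ n * Q)|); last first.
    by rewrite normQ; [ring | rewrite !mulr_ge0 ?exprn_ge0].
  congr (_ * `|_|).
  have -> : 5 * F ^+ 4 * L * ((-1) ^+ n * Q) =
      L * (5 * F ^+ 2) * (F ^+ 2 * ((-1) ^+ n * Q)) by ring.
  by rewrite -formE -L2; ring.
(* Here e = -1, so the same factor collapses to L^3. *)
- move: formE; rewrite par expr1 => formE.
  transitivity (2^-1 * `|(F ^+ 2 * L ^+ 3) * ((-1) ^+ n * Q)|); last first.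
    by rewrite normQ; [ring | rewrite !mulr_ge0 ?exprn_ge0].
  congr (_ * `|_|).
  have -> : F ^+ 2 * L ^+ 3 * ((-1) ^+ n * Q) =
      L ^+ 3 * (F ^+ 2 * ((-1) ^+ n * Q)) by ring.
  by rewrite -formE; ring.
Qed.
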